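(* Let $m\ge 1$, let $M\in\Lambda_{2m}^m$ and let $C$ be a critical set of $M$. Then there is a defining set $D$ for $M$ such that $D\subseteq M\setminus C$ and $|D|\le 4m^2-2m-|C|$.
   Context: $\Lambda_{n}^{x}$ is the set of $n\times n$ $(0,1)$-matrices with every row sum and every column sum equal to $x$. A matrix $M$ is identified with the set of triples $\{(i,j,M_{ij})\}$. A subset $D\subseteq M$ is a defining set for $M$ if $M$ is the unique element of $\Lambda_{2m}^m$ containing $D$; a critical set is a defining set none of whose proper subsets is a defining set. The size of such a set is its number of triples. *)

(* Defs.v *)
From mathcomp Require Import all_boot all_order all_algebra.

Set Implicit Arguments.
Unset Strict Implicit.
Unset Printing Implicit Defensive.

(* (0,1)-matrices are matrices over bool; the row and column sums are sums of
   natural numbers, through the coercion of bool to nat. *)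
Definition Lambda (n x : nat) : {set 'M[bool]_n} :=
  [set A : 'M[bool]_n | [forall i, \sum_(j < n) (A i j : nat) == x]
                     && [forall j, \sum_(i < n) (A i j : nat) == x]].

Definition triples (n : nat) (A : 'M[bool]_n) : {set 'I_n * 'I_n * bool} :=
  [set (ij, A ij.1 ij.2) | ij : 'I_n * 'I_n].

Definition defining_set (n x : nat) (M : 'M[bool]_n)
    (D : {set 'I_n * 'I_n * bool}) : Prop :=
  D \subset triples M /\
  unique (fun A : 'M[bool]_n => A \in Lambda n x /\ D \subset triples A) M.

Definition critical_set (n x : nat) (M : 'M[bool]_n)
    (C : {set 'I_n * 'I_n * bool}) : Prop :=
  defining_set x M C /\
  forall D : {set 'I_n * 'I_n * bool}, D \proper C -> ~ defining_set x M D.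

(* Main.v *)
(** Orient the cell [(i, j)] of [M] from row [i] to column [j] if it holds a 1
and from column [j] to row [i] if it holds a 0.  The cells in which two matrices
with the same line sums differ form a balanced set of arcs, so the defining sets
of [M] are its feedback arc sets.  Hence a critical set [C] consists of the
arcs that go up for some injective height [g] on the 2n lines, all other arcs
going down.  Let the top line be a row, say.  Then each column [x] lies below
some row; let [p x] be the lowest row above [x].  The arc between [p x] and [x]
goes down, for otherwise lifting [x] just above [p x] would show that [C] is not
minimal.  The arcs of [C] together with the n arcs from [p x] to [x] are still
acyclic: turn the order upside down and move every [x] right after [p x].  So
their complement is a defining set. *)
Require Import Defs.
From mathcomp Require Import all_boot all_order all_algebra.
From mathcomp Require Import zify.

Import Order.TTheory GRing.Theory Num.Theory.

Section Arcs.

Set Implicit Arguments.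
Unset Strict Implicit.

Variable n : nat.

Notation line := ('I_n + 'I_n)%type.
Notation arc := ('I_n * 'I_n * bool)%type.

Implicit Types (M A : 'M[bool]_n) (C D K : {set arc}) (t : arc) (u v : line).

(** * Cells as arcs between rows and columns *)

Definition tail t : line := if t.2 then inl t.1.1 else inr t.1.2.
Definition head t : line := if t.2 then inr t.1.2 else inl t.1.1.
Definition is_row v : bool := if v is inl _ then true else false.

Lemma is_row_head t : is_row (head t) = ~~ is_row (tail t).
Proof. by case: t => [[i j] []]. Qed.

Lemma mem_triples M i j b : ((i, j, b) \in triples M) = (M i j == b).
Proof.
apply/imsetP/eqP => [[[i' j'] _ /= [-> -> ->]] // | <-].
by exists (i, j).
Qed.

Lemma card_triples M : #|triples M| = n * n.
Proof. by rewrite card_imset ?card_prod ?card_ord // => u v []. Qed.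

Lemma triples_inj_sub M A : triples M \subset triples A -> M = A.
Proof.
move/subsetP=> sMA; apply/matrixP=> i j; apply/esym/eqP.
by rewrite -mem_triples sMA // mem_triples.
Qed.

Lemma triples_join M u v : is_row u != is_row v ->
  exists2 t, t \in triples M &
    tail t = u /\ head t = v \/ tail t = v /\ head t = u.
Proof.
case: u v => [i|j] [i'|j'] // _; [exists (i, j', M i j') | exists (i', j, M i' j)];
  rewrite ?mem_triples // /tail /head /=; case: (M _ _); by [left | right].
Qed.

(** A row and a column meet in a single cell, whose entry fixes the direction of the arc. *)
Lemma triples_asym M t t' : t \in triples M -> t' \in triples M ->
  tail t = head t' -> head t = tail t' -> False.
Proof.
case: t t' => [[i j] b] [[i' j'] b']; rewrite !mem_triples => /eqP <- /eqP <-.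
rewrite /tail /head /=; case E: (M i j); case E': (M i' j') => // -[ei] [ej];
  by rewrite ei ej E' in E.
Qed.

(** * Line sums and balanced arc sets *)

Lemma card_arcs_at (T : finType) (c : T -> arc) K (P : pred arc) :
    injective c -> (forall t, P t -> exists y, t = c y) ->
    (forall y, P (c y)) ->
  #|[set t in K | P t]| = \sum_y (c y \in K).
Proof.
move=> c_inj Pc cP.
rewrite -big_mkcond sum1_card -(card_imset _ c_inj).
apply: eq_card => t; rewrite inE; apply/andP/imsetP => [[Kt /Pc[y def_t]] | [y Ky ->]].
  by exists y => //; rewrite unfold_in /= -def_t.
by split; [exact: Ky | exact: cP].
Qed.

Definition out_arcs K v := [set t in K | tail t == v].
Definition in_arcs K v := [set t in K | head t == v].

(** Cell by cell: where the matrices differ, the arc leaves row [i] if [M] holds the 1 and enters it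
    if [A] does. Both sides are sums so as to avoid truncated subtraction. *)
Lemma row_sum_diff M A i :
  let K := triples M :\: triples A in
  \sum_j (A i j : nat) + #|out_arcs K (inl i)| =
  \sum_j (M i j : nat) + #|in_arcs K (inl i)|.
Proof.
move=> K; rewrite (@card_arcs_at _ (fun j => (i, j, true))); first last.
- by move=> j; rewrite /tail /=.
- by case=> [[i' j] []] // /eqP[->]; exists j.
- by move=> j j' [].
rewrite (@card_arcs_at _ (fun j => (i, j, false))); first last.
- by move=> j; rewrite /head /=.
- by case=> [[i' j] []] // /eqP[->]; exists j.
- by move=> j j' [].
rewrite -!big_split; apply: eq_bigr => j _ /=.
by rewrite !inE !mem_triples; case: (A i j); case: (M i j).
Qed.

Lemma col_sum_diff M A j :
  let K := triples M :\: triples A in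
  \sum_i (A i j : nat) + #|in_arcs K (inr j)| =
  \sum_i (M i j : nat) + #|out_arcs K (inr j)|.
Proof.
move=> K; rewrite (@card_arcs_at _ (fun i => (i, j, true))); first last.
- by move=> i; rewrite /head /=.
- by case=> [[i j'] []] // /eqP[->]; exists i.
- by move=> i i' [].
rewrite (@card_arcs_at _ (fun i => (i, j, false))); first last.
- by move=> i; rewrite /tail /=.
- by case=> [[i j'] []] // /eqP[->]; exists i.
- by move=> i i' [].
rewrite -!big_split; apply: eq_bigr => i _ /=.
by rewrite !inE !mem_triples; case: (A i j); case: (M i j).
Qed.

Lemma Lambda_balanced x M A :
  M \in Lambda n x ->
  A \in Lambda n x <-> forall v, #|out_arcs (triples M :\: triples A) v|
                              = #|in_arcs (triples M :\: triples A) v|.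
Proof.
rewrite !inE => /andP[/forallP Mrow /forallP Mcol]; split.
  move=> /andP[/forallP Arow /forallP Acol] [i|j].
    have := row_sum_diff M A i; rewrite (eqP (Arow i)) (eqP (Mrow i)).
    exact: addnI.
  have := col_sum_diff M A j; rewrite (eqP (Acol j)) (eqP (Mcol j)).
  by move/addnI.
move=> bal; apply/andP; split; apply/forallP => y.
  move: (row_sum_diff M A y) => /=; rewrite bal (eqP (Mrow y)).
  by move/addIn => ->.
move: (col_sum_diff M A y) => /=; rewrite bal (eqP (Mcol y)).
by move/addIn => ->.
Qed.

(** * Defining sets as feedback arc sets *)

Lemma potential_defining x M D (g : line -> int) :
    M \in Lambda n x -> D \subset triples M ->
    (forall t, t \in triples M :\: D -> (g (head t) < g (tail t))%R) ->
  defining_set x M D.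
Proof.
move=> LM sDM dec; do 2!split=> //.
move=> A [LA sDA]; apply: triples_inj_sub.
rewrite -setD_eq0; apply/eqP; set K := _ :\: _.
have bal v : #|out_arcs K v| = #|in_arcs K v| by apply: (Lambda_balanced _ LM).1.
have decK t : t \in K -> (g (head t) < g (tail t))%R.
  rewrite inE => /andP[At Mt]; apply: dec; rewrite inE Mt andbT.
  by apply: contra At => /(subsetP sDA).
(* If [K] were nonempty, take an arc of [K] with lowest head. By balance an arc of [K] leaves that
   head, and it ends lower still. *)
case: (set_0Vmem K) => // -[t0 Kt0].
case: (arg_minP (fun t => g (head t)) Kt0) => t Kt min_t.
have: 0 < #|out_arcs K (head t)|.
  by rewrite bal; apply/card_gt0P; exists t; apply/setIdP.
case/card_gt0P=> t' /setIdP[Kt' /eqP tail_t'].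
by have := decK _ Kt'; rewrite tail_t' ltNge min_t.
Qed.

(* Otherwise following arcs outside [D] leads to a set [Z] of lines that the
   successor map permutes; switching these arcs gives another matrix. *)
Lemma defining_has_sink x M D (U : {set line}) :
    M \in Lambda n x -> defining_set x M D -> U != set0 ->
  exists2 u, u \in U & forall t, t \in triples M :\: D -> tail t = u ->
    head t \notin U.
Proof.
move=> LM [sDM [_ uniqM]] /set0Pn[u0 Uu0].
pose no_exit u := [forall t,
  (t \in triples M :\: D) && (tail t == u) ==> (head t \notin U)].
have [/exists_inP[u Uu /forallP sink_u]|] := boolP [exists u in U, no_exit u].
  by exists u => // t Kt tl; have := sink_u t; rewrite Kt tl eqxx.
rewrite negb_exists_in => /forall_inP no_sink.
have next u : u \in U ->
    exists t, [/\ t \in triples M :\: D, tail t = u & head t \in U].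
  move/no_sink; rewrite negb_forall => /existsP[t].
  by rewrite negb_imply negbK => /andP[/andP[Kt /eqP tl] Ut]; exists t.
(* [t0] is only a default value for [nx] outside [U]. *)
have [t0 _] := next _ Uu0.
have [nx nxP] : exists nx : line -> arc, forall u, u \in U ->
    [/\ nx u \in triples M :\: D, tail (nx u) = u & head (nx u) \in U].
  apply: (@fin_all_exists _ (fun=> arc)
    (fun u t => u \in U -> [/\ t \in triples M :\: D, tail t = u & head t \in U])).
  move=> u; case: (boolP (u \in U)) => [/next[t tP]|_]; last by exists t0.
  by exists t.
pose h u := head (nx u).
pose stable (Z : {set line}) := (Z != set0) && (h @: Z \subset Z).
have stableU : stable U.
  apply/andP; split; first by apply/set0Pn; exists u0.
  by apply/subsetP=> _ /imsetP[u Uu ->]; case: (nxP u Uu).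
have [Z minZ sZU] := minset_exists stableU.
have /andP[Z0 hZ] := minsetp minZ.
(* The image of a stable set is stable, so minimality makes [h] surjective on [Z], hence injective
   there. Each line of [Z] then has one arc of [K] out and one in. *)
have hZE : h @: Z = Z.
  apply: (minsetinf minZ) => //; rewrite /stable imsetS // andbT.
  by case/set0Pn: Z0 => z Zz; apply/set0Pn; exists (h z); apply: imset_f.
have h_inj : {in Z &, injective h} by apply/imset_injP; rewrite hZE.
pose K := nx @: Z.
have KP t : t \in K -> t \in triples M :\: D.
  by case/imsetP=> z /(subsetP sZU)/nxP[? _ _] ->.
pose N : 'M_n := (\matrix_(i, j) (M i j (+) ((i, j, M i j) \in K)))%R.
have KE : triples M :\: triples N = K.
  apply/setP=> -[[i j] b]; rewrite inE !mem_triples mxE.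
  case: (M i j =P b) => [-> | /eqP ne].
    by rewrite andbT; case: b (_ \in K) => [] [].
  rewrite andbF; apply/esym/negbTE; apply: contra ne => /KP.
  by rewrite inE mem_triples => /andP[].
have LN : N \in Lambda n x.
  apply/(Lambda_balanced _ LM) => v; rewrite KE.
  have [Zv | Zv] := boolP (v \in Z); last first.
    rewrite (_ : out_arcs K v = set0) 1?(_ : in_arcs K v = set0) //.
      apply/setP=> t; rewrite !inE; apply: contraNF Zv => /andP[/imsetP[z Zz ->]].
      by move/eqP <-; rewrite -hZE (imset_f h).
    apply/setP=> t; rewrite !inE; apply: contraNF Zv => /andP[/imsetP[z Zz ->]].
    by case: (nxP z (subsetP sZU z Zz)) => _ -> _ /eqP <-.
  have [_ tl_v _] := nxP _ (subsetP sZU _ Zv).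
  rewrite (_ : out_arcs K v = [set nx v]); last first.
    apply/setP=> t; rewrite !inE; apply/andP/eqP=> [[/imsetP[z Zz ->]]|->].
      by case: (nxP z (subsetP sZU z Zz)) => _ -> _ /eqP ->.
    by rewrite imset_f // tl_v.
  move: (Zv); rewrite -{1}hZE => /imsetP[z Zz def_v].
  rewrite (_ : in_arcs K v = [set nx z]) ?cards1 //.
  apply/setP=> t; rewrite !inE; apply/andP/eqP=> [[/imsetP[z' Zz' ->]]|->].
    by rewrite def_v => /eqP/h_inj ->.
  by rewrite imset_f // def_v.
(* The switched arcs avoid [D], so uniqueness applies to [N]; but [K] is nonempty. *)
have MN : M = N.
  apply: uniqM; split=> //; apply/subsetP=> t Dt.
  apply: contraT => Nt; have: t \in K by rewrite -KE inE Nt (subsetP sDM).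
  by move/KP; rewrite inE Dt.
case/set0Pn: Z0 => z Zz.
have: nx z \in K by apply: imset_f.
by rewrite -KE -MN setDv inE.
Qed.

(** Sinks are removed one at a time, each being placed below all the lines that remain. *)
Lemma defining_height x M D :
    M \in Lambda n x -> defining_set x M D ->
  exists2 g : line -> nat, injective g &
    forall t, t \in triples M :\: D -> g (head t) < g (tail t).
Proof.
move=> LM defD.
have height_on (U : {set line}) : exists g : line -> nat,
    forall t, t \in triples M :\: D -> head t \in U -> tail t \in U ->
      g (head t) < g (tail t).
  have [k] := ubnP #|U|; elim: k U => // k IHk U; rewrite ltnS => leUk.
  have [-> | U0] := eqVneq U set0; first by exists (fun=> 0) => t _; rewrite inE.
  have [u Uu sink_u] := defining_has_sink LM defD U0.
  have [|g gP] := IHk (U :\ u); first by rewrite (cardsD1 u) Uu add1n in leUk.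
  exists (fun v => if v == u then 0 else (g v).+1) => t Kt Uh Ut.
  case: (tail t =P u) => [tl|/eqP tl]; first by rewrite (negPf (sink_u t Kt tl)) in Uh.
  case: eqP => // /eqP hd.
  by rewrite ltnS; apply: gP; rewrite // !inE ?hd ?tl.
have [g gP] := height_on setT.
(* The rank acts as a low-order digit: it breaks ties and preserves strict inequalities. *)
exists (fun v => g v * #|{: line}| + enum_rank v) => [u v eq_g | t Kt].
  apply: enum_rank_inj; apply: ord_inj.
  have := congr1 (modn^~ #|{: line}|) eq_g.
  by rewrite !modnMDl !modn_small.
have lt_g : g (head t) < g (tail t) by rewrite gP ?in_setT.
apply: (@leq_trans ((g (head t)).+1 * #|{: line}|)).
  by rewrite mulSn addnC ltn_add2r.
by rewrite (leq_trans _ (leq_addr _ _)) // leq_mul2r lt_g orbT.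
Qed.

(** * Heights of critical sets *)

Lemma critical_height x M C :
    M \in Lambda n x -> critical_set x M C ->
  exists2 g : line -> nat, injective g &
    forall t, t \in triples M -> (t \in C) = (g (tail t) < g (head t)).
Proof.
move=> LM [defC minC]; have [g g_inj gP] := defining_height LM defC.
exists g => // t Mt; case: (boolP (t \in C)) => Ct; last first.
  by apply/esym/negbTE; rewrite -leqNgt ltnW // gP // inE Ct.
apply/esym; case: ltngtP => // [lt_ht | eq_g]; last first.
  by have := is_row_head t; rewrite (g_inj _ _ eq_g); case: (is_row _).
case: (minC (C :\ t)); first exact: properD1.
apply: (potential_defining (g := fun v => Posz (g v))) => //.
  by apply: subset_trans (subsetDl _ _) _; case: defC.
move=> t'; rewrite !inE negb_and negbK ltz_nat => /andP[/orP[/eqP -> //|Ct'] Mt'].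
by apply: gP; rewrite inE Ct'.
Qed.

(* If the arc went from [v] up to [u], lifting [v] to just above [u] would show
   that it is superfluous in [C]. *)
Lemma critical_arc_down x M C (g : line -> nat) u v :
    M \in Lambda n x -> critical_set x M C -> injective g ->
    (forall t, t \in triples M -> (t \in C) = (g (tail t) < g (head t))) ->
    is_row u != is_row v -> g v < g u ->
    (forall w, is_row w = is_row u -> g v < g w -> g u <= g w) ->
  exists t, [/\ t \in triples M :\: C, tail t = u & head t = v].
Proof.
move=> LM [defC minC] g_inj CE uv gvu min_u.
have [t Mt [[tl hd] | [tl hd]]] := triples_join M uv.
  by exists t; split=> //; rewrite inE Mt CE // tl hd -leqNgt ltnW.
have Ct : t \in C by rewrite CE // tl hd.
case: (minC (C :\ t)); first exact: properD1.
(* Doubling the heights makes room for [v] just above [u]. *)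
pose g' w := if w == v then (g u).*2.+1 else (g w).*2.
apply: (potential_defining (g := fun w => Posz (g' w))) => //.
  by apply: subset_trans (subsetDl _ _) _; case: defC.
have ne_uv : u != v by apply: contraNneq uv => ->.
move=> t'; rewrite !inE negb_and negbK ltz_nat => /andP[/orP[/eqP -> |Ct'] Mt'].
  by rewrite /g' tl hd eqxx (negPf ne_uv).
have := Ct'; rewrite CE // -leqNgt leq_eqVlt => /orP[/eqP/g_inj eq_th | gt'].
  by have := is_row_head t'; rewrite eq_th; case: (is_row _).
(* The tail of an arc outside [C] into [v] is on the side of [u] and above [v], so at least as high
   as [u] by [min_u]. It is not [u], because the arc between [u] and [v] points the other way. *)
rewrite /g'; case: (head t' =P v) => [hd' | _].
  have ne_tv : tail t' != v by apply: contraTneq gt' => ->; rewrite hd' ltnn.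
  have ne_tu : tail t' != u.
    apply/eqP=> tl'; apply: (triples_asym Mt Mt'); first by rewrite tl hd'.
    by rewrite hd tl'.
  rewrite (negPf ne_tv) ltn_Sdouble ltn_neqAle; apply/andP; split.
    by apply: contra ne_tu => /eqP/g_inj ->.
  apply: min_u; last by rewrite -hd'.
  by have := is_row_head t'; rewrite hd'; move: uv; do 3!case: (is_row _).
case: (tail t' =P v) => [tl' | _]; last by rewrite ltn_double.
by rewrite ltnS leq_double ltnW // (leq_trans gt') // tl' ltnW.
Qed.

(** * A defining set in the complement *)

Lemma card_side (b : bool) : #|[set v : line | is_row v == b]| = n.
Proof.
case: b.
  rewrite -[RHS]card_ord -(@card_imset _ _ (@inl 'I_n 'I_n)) ?cardsT; last first.
    by move=> i j [].
  apply: eq_card => -[i|j]; rewrite inE; apply/esym/imsetP.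
    by exists i.
  by case.
rewrite -[RHS]card_ord -(@card_imset _ _ (@inr 'I_n 'I_n)) ?cardsT; last first.
  by move=> i j [].
apply: eq_card => -[i|j]; rewrite inE; apply/esym/imsetP; first by case.
by exists j.
Qed.

Theorem critical_complement_defining x M C :
    0 < n -> M \in Lambda n x -> critical_set x M C ->
  exists D, [/\ defining_set x M D, D \subset triples M :\: C &
    #|D| + n + #|C| = n * n].
Proof.
move=> n_gt0 LM critC; have [g g_inj CE] := critical_height LM critC.
have sCM : C \subset triples M by case: critC => -[].
case: (@arg_maxnP _ (inl (Ordinal n_gt0)) xpredT g isT) => top _ topP.
(* Each line of [T] has [top] above it on the other side, so there is a lowest such line, from which
   [s] will take its arc. *)
pose T := [set v | is_row v == ~~ is_row top].
have [t0 _] : exists t : arc, True by exists (Ordinal n_gt0, Ordinal n_gt0, true).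
have [s sP] : exists s : line -> arc, forall v, v \in T ->
    [/\ s v \in triples M :\: C, head (s v) = v &
      forall w, w \notin T -> g v < g w -> g (tail (s v)) <= g w].
  apply: (@fin_all_exists _ (fun=> arc) (fun v t => v \in T ->
    [/\ t \in triples M :\: C, head t = v &
      forall w, w \notin T -> g v < g w -> g (tail t) <= g w])) => v.
  case: (boolP (v \in T)) => [Tv | _]; last by exists t0.
  pose above w := (w \notin T) && (g v < g w).
  have top_v : above top.
    have T'top : top \notin T by rewrite inE; case: (is_row _).
    rewrite /above T'top ltn_neqAle [_ <= _]topP // andbT.
    by apply: contra T'top => /eqP/g_inj <-.
  case: (@arg_minnP _ top above g top_v) => u /andP[T'u gvu] min_u.
  have [] := critical_arc_down LM critC g_inj CE _ gvu (u := u).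
  - by move: T'u Tv; rewrite !inE; do 3!case: (is_row _).
  - move=> w wu gw; apply: min_u; rewrite /above gw andbT.
    by move: T'u; rewrite !inE wu.
  move=> t [Kt tl hd]; exists t => _; split=> // w T'w gvw.
  by rewrite tl min_u // /above T'w.
pose S := s @: T.
have sS : S \subset triples M :\: C.
  by apply/subsetP=> _ /imsetP[v Tv ->]; case: (sP v Tv).
have s_inj : {in T &, injective s}.
  by move=> v w /sP[_ hdv _] /sP[_ hdw _] eq_s; rewrite -hdv eq_s.
exists (triples M :\: C :\: S); split; last 1 first.
- have := cardsID S (triples M :\: C); rewrite (setIidPr sS).
  have := cardsID C (triples M); rewrite (setIidPr sCM) card_triples.
  rewrite card_in_imset // card_side => <- <-.
  by rewrite addnC [_ + n]addnC.
(* Negation turns the order upside down, and the extra [- 1] puts each [v] in [T] right after the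
   tail of [s v]; doubling leaves room for it. Lines of [T] may share a value, as no arc joins
   them. *)
- pose f v := (if v \in T then - (g (tail (s v))).*2%:Z - 1 else - (g v).*2%:Z)%R.
  apply: (potential_defining (g := f)) => //.
    by rewrite setDDl subsetDl.
  have side t : (head t \in T) = (tail t \notin T).
    by rewrite !inE is_row_head; do 2!case: (is_row _).
  have CE' t : t \in triples M :\: C -> t \in triples M /\ g (head t) < g (tail t).
    rewrite in_setD => /andP[Ct Mt]; split=> //.
    rewrite CE // -leqNgt leq_eqVlt in Ct; case/orP: Ct => // /eqP/g_inj eq_ht.
    by have := side t; rewrite eq_ht; case: (_ \in T).
  move=> t; rewrite in_setD => /andP[Dt Mt].
  have [/imsetP[v Tv def_t] | St] := boolP (t \in S).
    have [_ hd _] := sP v Tv; have := side t.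
    by rewrite def_t hd Tv /f Tv => /esym/negPf->; lia.
  have Ct : t \in C by move: Dt; rewrite in_setD St in_setD Mt andbT negbK.
  have gt : g (tail t) < g (head t) by rewrite -CE.
  have := side t; rewrite /f; have [Tt | T't] := boolP (tail t \in T) => T_hd.
    (* An arc of [C] leaving a line of [T] ends no lower than the tail of [s (tail t)], and not at
       that tail, since [s (tail t)] would be its reverse. *)
    have [/CE'[Ms _] hd low] := sP _ Tt; rewrite T_hd /=.
    have le_g : g (tail (s (tail t))) <= g (head t) by rewrite low ?T_hd.
    have ne_g : g (tail (s (tail t))) != g (head t).
      by apply/eqP=> /g_inj tl; apply: (triples_asym Mt Ms).
    by lia.
  by rewrite T_hd /=; have [/CE'[_ down] hd _] := sP _ T_hd; rewrite hd in down; lia.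
- exact: subsetDl.
Qed.

End Arcs.

Theorem theorem11 (m : nat) (m_ge1 : 1 <= m) (M : 'M[bool]_(2 * m))
    (M_Lambda : M \in Lambda (2 * m) m)
    (C : {set 'I_(2 * m) * 'I_(2 * m) * bool})
    (C_critical : critical_set m M C) :
  exists D : {set 'I_(2 * m) * 'I_(2 * m) * bool},
    [/\ defining_set m M D,
        D \subset triples M :\: C
      & (#|D|%:Z <= 4 * m%:Z ^+ 2 - 2 * m%:Z - #|C|%:Z)%R].
Proof.
have n_gt0 : 0 < 2 * m by lia.
have [D [defD sD cardD]] := critical_complement_defining n_gt0 M_Lambda C_critical.
exists D; split=> //; nia.
Qed.
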